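(* Let $d,n,m\ge 1$ be integers, let $f_1,\dots,f_n:\mathbb{R}^d\to\mathbb{R}$ be $C^1$ functions, put $f(x)=\frac1n\sum_{i=1}^n f_i(x)$, and let $g_j(x)=a_j^\top x+b_j$ with $a_j\in\mathbb{R}^d$, $b_j\in\mathbb{R}$, $j=1,\dots,m$. Assume: (1) There exist constants $0<\mu\le L$ such that for all $x,y\in\mathbb{R}^d$ and all $i\in\{1,\dots,n\}$, $$f_i(y)-f_i(x)\le \nabla f_i(x)^\top(y-x)+\tfrac{L}{2}\|y-x\|_2^2,\qquad f_i(y)-f_i(x)\ge \nabla f_i(x)^\top (y-x),$$ $$f(y)-f(x)\ge \nabla f(x)^\top(y-x)+\tfrac{\mu}{2}\|y-x\|_2^2 .$$ (2) The set $\mathbb{X}=\{x\in\mathbb{R}^d: g_j(x)\le 0,\ j=1,\dots,m\}$ has non-empty interior. (3) $i_k$ and $j_k$, $k\ge 0$, are independent random variables, with each $i_k$ uniformly distributed on $\{1,\dots,n\}$ and each $j_k$ uniformly distributed on $\{1,\dots,m\}$. Let $\delta_\infty>0$ and let $\{\gamma_k\}_{k\ge0}$, $\{\varepsilon_k\}_{k\ge0}$, $\{\delta_k\}_{k\ge0}$ be sequences of positive real numbers with $\delta_k=\delta_\infty+\varepsilon_k$ for all $k$ and $$\sum_{k=0}^\infty\gamma_k=\infty,\qquad \sum_{k=0}^\infty\gamma_k^2<\infty,\qquad \sum_{k=0}^\infty\gamma_k\varepsilon_k<\infty .$$ Let $x_0\in\mathbb{R}^d$ and let $\{X_k\}_{k\ge0}$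 be the sequence of random variables defined by $X_0=x_0$ and $$X_{k+1}=X_k-\gamma_k\big(\nabla f_{i_k}(X_k)+\nabla B(g_{j_k}(X_k),\delta_k)\big),\qquad k\ge0,$$ where $B$ is the relaxed logarithmic barrier function. Then $$\lim_{k\to\infty}X_k = x^*(\delta_\infty)\quad\text{almost surely},$$ where $x^*(\delta_\infty)=\operatorname{argmin}_{x\in\mathbb{R}^d}\Big( f(x)+\frac1m\sum_{j=1}^m B(g_j(x),\delta_\infty)\Big)$.
   Context: The relaxed logarithmic barrier function $B:\mathbb{R}\times(0,\infty)\to\mathbb{R}$ is defined by $$B(z,\delta)=\begin{cases}-\delta\log(-z), & z<-\delta,\\[2pt] \frac12\left(\frac{(z+2\delta)^2}{\delta}-\delta\right)-\delta\log(\delta), & z\ge-\delta.\end{cases}$$ For fixed $\delta>0$ and $j$, $\nabla B(g_j(x),\delta)$ denotes the gradient with respect to $x\in\mathbb{R}^d$ of the function $x\mapsto B(g_j(x),\delta)$. $\|\cdot\|_2$ is the Euclidean norm. All random variables are defined on a common probability space. The initial point $x_0$ is deterministic. *)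

(* Defs.v *)
From HB Require Import structures.
From mathcomp Require Import all_boot all_order all_algebra.
From mathcomp Require Import finmap.
From mathcomp Require Import all_classical all_reals all_analysis.

Set Implicit Arguments.
Unset Strict Implicit.
Unset Printing Implicit Defensive.

Import Order.TTheory GRing.Theory Num.Theory.
Import numFieldNormedType.Exports.

Local Open Scope classical_set_scope.
Local Open Scope ring_scope.

(* Index sets of positive cardinality, with the discrete sigma-algebra. *)
HB.instance Definition _ (n : nat) := isPointed.Build 'I_n.+1 ord0.

HB.instance Definition _ (n : nat) := @isMeasurable.Build
  default_measure_display 'I_n.+1 discrete_measurable discrete_measurable0
  discrete_measurableC discrete_measurableU.

Definition dot (R : realType) (d : nat) (u v : 'rV[R]_d) : R :=
  \sum_(k < d) u 0 k * v 0 k.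

(* The library norm on row vectors is the sup norm; it induces the same topology
   but is not the norm meant in quantitative bounds. *)
Definition norm2 (R : realType) (d : nat) (u : 'rV[R]_d) : R :=
  Num.sqrt (dot u u).

Definition grad (R : realType) (d : nat) (F : 'rV[R]_d -> R) (x : 'rV[R]_d) :
    'rV[R]_d :=
  \row_(k < d) 'D_(delta_mx 0 k) F x.

Definition C1 (R : realType) (d : nat) (F : 'rV[R]_d -> R) : Prop :=
  (forall x, differentiable F x) /\ continuous (grad F).

Definition argmin (T : Type) (R : realType) (F : T -> R) : set T :=
  [set x | forall y, F x <= F y].

Definition relaxed_barrier (R : realType) (z delta : R) : R :=
  if z < - delta then - delta * ln (- z)
  else 2^-1 * ((z + 2 * delta) ^+ 2 / delta - delta) - delta * ln delta.

(* Preimages of the measurable sets of E already form a sigma-algebra, so no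
   closure is needed. *)
Definition sigma_of (T : Type) (d' : measure_display) (E : measurableType d')
    (Y : T -> E) : set_system T :=
  preimage_set_system setT Y measurable.

(* Mutual independence: the product rule over every finite subfamily. Taking
   sigma-algebras rather than random variables lets the family mix variables
   with different codomains. *)
Definition independent_sigma_algebras (d : measure_display)
    (T : measurableType d) (R : realType) (P : probability T R)
    (I : choiceType) (G : I -> set_system T) : Prop :=
  forall (J : {fset I}) (A : I -> set T),
    (forall i, i \in J -> G i (A i)) ->
    P (\bigcap_(i in [set` J]) A i) = (\prod_(i <- J) P (A i))%E.

Definition uniform_on_ord (d : measure_display) (T : measurableType d)
    (R : realType) (P : probability T R) (n : nat) (Y : T -> 'I_n) : Prop :=
  forall i : 'I_n, P (Y @^-1` [set i]) = (n%:R^-1 : R)%:E.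

(* Main.v *)
Require Import Defs.
From mathcomp Require Import all_boot all_order all_algebra finmap.
From mathcomp Require Import all_classical all_reals all_analysis.
From mathcomp Require Import ring lra.
Import Order.TTheory GRing.Theory Num.Theory.
Import numFieldNormedType.Exports.
Local Open Scope classical_set_scope.
Local Open Scope ring_scope.

(* Let V(x) = |x - x*|^2 and let U_k be the one-step averaging operator of the
   algorithm at time k. Strong convexity, the Lipschitz gradients of the sampled
   terms and the O(epsilon_k) bias of the gradient at x* give
     U_k V <= (1 + beta_k - 2 mu gamma_k) V + beta_k,  sum_k beta_k < oo.
   Hence phi_k = exp(- sum_(l<k) beta_l) V + sum_(l>=k) beta_l is a
   supermartingale along the iterates, with drift at most - c gamma_k V. As
   sum_k gamma_k = oo, the mean of phi_k gets arbitrarily small, and Ville's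
   maximal inequality turns this into almost sure convergence. The draws take
   finitely many values, so no conditional expectation is needed: Ville's
   inequality is a backward induction over the cylinders of past draws, which by
   independence all have probability q^k with q = 1/(nm). *)

(** * The relaxed barrier *)

Section Barrier.
Context {R : realType}.
Implicit Types z w delta : R.

(** Both sides are [ln (1 + u) <= u]: at [u = t - 1] for the upper bound and at [u = t^-1 - 1] for
    the lower one. *)
Lemma ln_bounds (t : R) : 0 < t -> 1 - t^-1 <= ln t <= t - 1.
Proof.
move=> t0; apply/andP; split; last first.
  have := @le_ln1Dx R (t - 1); rewrite addrCA subrr addr0; apply; lra.
have tV0 : 0 < t^-1 by rewrite invr_gt0.
have := @le_ln1Dx R (t^-1 - 1); rewrite addrCA subrr addr0 lnV ?posrE //.
by move=> /(_ ltac:(lra)); lra.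
Qed.

(** The [z]-derivative of [relaxed_barrier], as a formula. The barrier is never differentiated
    directly: the quadratic bounds on [bregman] identify the gradient through [sandwiched_grad]. *)
Definition dbarrier z delta : R :=
  if z < - delta then - delta / z else (z + 2 * delta) / delta.

Definition bregman z w delta : R :=
  relaxed_barrier w delta - relaxed_barrier z delta
  - dbarrier z delta * (w - z).

(** With [t = w / z] the divergence is [delta * (t - 1 - ln t)], which [ln_bounds] places between 0
    and [(w - z)^2 * delta / (w * z)], where [w * z >= delta^2]. The branch formulas are hypotheses
    so that the endpoint [- delta], which the definitions assign to the quadratic branch, is
    covered. *)
Lemma bregman_log z w delta : 0 < delta -> z <= - delta -> w <= - delta ->
  relaxed_barrier z delta = - delta * ln (- z) ->
  relaxed_barrier w delta = - delta * ln (- w) ->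
  dbarrier z delta = - delta / z ->
  0 <= bregman z w delta <= (w - z) ^+ 2 / delta.
Proof.
move=> d0 hz hw Bz Bw Dz; rewrite /bregman Bz Bw Dz.
have t0 : 0 < w / z by rewrite -mulrNN -invrN mulr_gt0 ?invr_gt0; lra.
have zN0 : z != 0 by lra.
have wN0 : w != 0 by lra.
have /andP[l1 l2] := ln_bounds _ t0.
have -> : - delta * ln (- w) - - delta * ln (- z) - - delta / z * (w - z)
   = delta * ((w / z) - 1 - ln (w / z)).
  have -> : ln (w / z) = ln (- w) - ln (- z).
    by rewrite -mulrNN -invrN ln_div ?posrE; lra.
  by field.
apply/andP; split; first by rewrite mulr_ge0; lra.
have : delta * (w / z - 1 - ln (w / z)) <= delta * (w / z - 1 - (1 - (w / z)^-1)).
  by rewrite ler_pM2l //; lra.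
move=> /le_trans; apply.
have -> : delta * (w / z - 1 - (1 - (w / z)^-1)) = (w - z) ^+ 2 * (delta / (w * z)).
  by field; rewrite zN0.
apply: ler_wpM2l; first exact: sqr_ge0.
rewrite ler_pdivrMr; last by nra.
rewrite mulrC ler_pdivlMr //; nra.
Qed.

Lemma bregman_quad z w delta : 0 < delta ->
  - delta <= z -> - delta <= w ->
  0 <= bregman z w delta <= (w - z) ^+ 2 / delta.
Proof.
move=> d0 hz hw; rewrite /bregman /relaxed_barrier /dbarrier !ltNge hz hw /=.
set e := (X in 0 <= X <= _).
have -> : e = 2^-1 * ((w - z) ^+ 2 / delta) by rewrite /e; field; lra.
have : 0 <= (w - z) ^+ 2 / delta by rewrite divr_ge0 ?sqr_ge0 ?ltW.
lra.
Qed.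

Lemma relaxed_barrier_log z delta : 0 < delta -> z <= - delta ->
  relaxed_barrier z delta = - delta * ln (- z).
Proof.
move=> d0; rewrite le_eqVlt /relaxed_barrier => /predU1P[->|->//].
by rewrite ltxx opprK; field; lra.
Qed.

Lemma dbarrier_log z delta : 0 < delta -> z <= - delta ->
  dbarrier z delta = - delta / z.
Proof.
move=> d0; rewrite le_eqVlt /dbarrier => /predU1P[->|->//].
by rewrite ltxx; field; lra.
Qed.

(* Both branches of [B] and of its derivative agree at [- delta], so a mixed
   pair is handled by splitting the Bregman divergence at [p = - delta]. *)
Lemma bregman_bound z w delta : 0 < delta ->
  0 <= bregman z w delta <= (w - z) ^+ 2 / delta.
Proof.
move=> d0; have [hz|hz] := lerP z (- delta); have [hw|hw] := lerP w (- delta).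
- by apply: bregman_log; rewrite ?relaxed_barrier_log ?dbarrier_log.
- set p := - delta; have zp : z < 0 by lra.
  have /andP[h1 h2] : 0 <= bregman z p delta <= (p - z) ^+ 2 / delta.
    by apply: bregman_log; rewrite ?relaxed_barrier_log ?dbarrier_log // lexx.
  have /andP[h3 h4] : 0 <= bregman p w delta <= (w - p) ^+ 2 / delta.
    by apply: bregman_quad; rewrite // ?lexx ?ltW.
  have -> : bregman z w delta = bregman z p delta + bregman p w delta
      + (dbarrier p delta - dbarrier z delta) * (w - p).
    by rewrite /bregman; ring.
  have Dp : dbarrier p delta = 1 by rewrite dbarrier_log //; rewrite /p; field; lra.
  have Dz : dbarrier z delta = - delta / z by rewrite dbarrier_log.
  (* The change of slope from [z] to [p] is at most [(p - z) / delta], so the correction term is at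
     most half the cross term in the expansion of [(w - z)^2 / delta] around [p]. *)
  have d1 : 0 <= 1 - (- delta / z) <= (p - z) / delta.
    have -> : 1 - (- delta / z) = (z - p) / z by rewrite /p; field; lra.
    rewrite -mulrNN -invrN opprB.
    apply/andP; split; first by rewrite divr_ge0 // /p; lra.
    by apply: ler_wpM2l; rewrite ?lef_pV2 ?posrE /p; lra.
  have /andP[h5 h6] : 0 <= (1 - (- delta / z)) * (w - p) <= (p - z) / delta * (w - p).
    have /andP[? ?] := d1.
    by apply/andP; split; [apply: mulr_ge0|apply: ler_wpM2r]; rewrite // /p; lra.
  rewrite Dp Dz; apply/andP; split; first lra.
  have : 0 <= (p - z) / delta * (w - p).
    by rewrite mulr_ge0 ?divr_ge0 // /p; lra.
  have -> : (w - z) ^+ 2 / delta = (w - p) ^+ 2 / delta + (p - z) ^+ 2 / delta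
     + 2 * ((p - z) / delta * (w - p)) by field; lra.
  lra.
- set p := - delta; have zp : w < 0 by lra.
  have /andP[h1 h2] : 0 <= bregman z p delta <= (p - z) ^+ 2 / delta.
    by apply: bregman_quad; rewrite // ?lexx ?ltW.
  have /andP[h3 h4] : 0 <= bregman p w delta <= (w - p) ^+ 2 / delta.
    by apply: bregman_log; rewrite ?relaxed_barrier_log ?dbarrier_log // lexx.
  have -> : bregman z w delta = bregman z p delta + bregman p w delta
      + (dbarrier z delta - dbarrier p delta) * (p - w).
    by rewrite /bregman; ring.
  have Dp : dbarrier p delta = 1 by rewrite dbarrier_log //; rewrite /p; field; lra.
  have Dz : dbarrier z delta = (z + 2 * delta) / delta.
    by rewrite /dbarrier ltNge (ltW hz).
  have -> : dbarrier z delta - dbarrier p delta = (z - p) / delta.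
    by rewrite Dz Dp /p; field; lra.
  have : 0 <= (z - p) / delta * (p - w).
    by rewrite mulr_ge0 ?divr_ge0 // /p; lra.
  have -> : (w - z) ^+ 2 / delta = (w - p) ^+ 2 / delta + (p - z) ^+ 2 / delta
     + 2 * ((z - p) / delta * (p - w)) by field; lra.
  by move=> ?; apply/andP; split; lra.
- by apply: bregman_quad; rewrite // ltW.
Qed.

(** The bound is uniform in [delta >= delta_oo], which lets one growth constant serve at all
    times. *)
Lemma dbarrier_bound z delta_oo delta : 0 < delta_oo -> delta_oo <= delta ->
  `|dbarrier z delta| <= 2 + `|z| / delta_oo.
Proof.
move=> d0 hd; have dd : 0 < delta by lra.
have zd : 0 <= `|z| / delta_oo by rewrite divr_ge0 // ltW.
rewrite /dbarrier; case: ltP => hz.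
  rewrite -mulrNN -invrN opprK ger0_norm; last by rewrite divr_ge0; lra.
  by apply: (@le_trans _ _ 1); [rewrite ler_pdivrMr; lra|lra].
rewrite mulrDl mulfK; last lra.
apply: (le_trans (ler_normD _ _)); rewrite (@ger0_norm _ 2) // addrC lerD2l.
rewrite normrM (@ger0_norm _ delta^-1) ?invr_ge0 ?(ltW dd) //.
by apply: ler_wpM2l => //; rewrite lef_pV2 ?posrE.
Qed.

(** Source of the O(epsilon_k) bias. As [- delta <= - delta_oo], three cases survive: both
    logarithmic, quadratic for [delta] only, both quadratic. The first two are paid by the
    [delta_oo^-1] term, the last by the [|z|] term. *)
Lemma dbarrier_lip_delta z delta_oo delta : 0 < delta_oo -> delta_oo <= delta ->
  `|dbarrier z delta - dbarrier z delta_oo|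
    <= (delta - delta_oo) * (delta_oo^-1 + `|z| / delta_oo ^+ 2).
Proof.
move=> d0 hd; have dd : 0 < delta by lra.
have dV : 0 < delta_oo^-1 by rewrite invr_gt0.
have dV2 : 0 < delta^-1 by rewrite invr_gt0.
have dVV : delta^-1 <= delta_oo^-1 by rewrite lef_pV2.
have e0 : 0 <= delta - delta_oo by lra.
have zd : 0 <= `|z| / delta_oo ^+ 2 by rewrite divr_ge0 // exprn_ge0 // ltW.
rewrite mulrDr; have t1 : 0 <= (delta - delta_oo) * (`|z| / delta_oo ^+ 2).
  exact: mulr_ge0.
have t2 : 0 <= (delta - delta_oo) / delta_oo by rewrite mulr_ge0 // ltW.
rewrite /dbarrier; case: ltP => hz; case: ltP => hz'; try lra.
- have z0 : z < 0 by lra.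
  have -> : - delta / z - - delta_oo / z = (delta - delta_oo) / - z by field; lra.
  rewrite ger0_norm; last by rewrite divr_ge0; lra.
  apply: ler_wpDr => //; apply: ler_wpM2l => //; rewrite lef_pV2 ?posrE; lra.
- have -> : (z + 2 * delta) / delta - - delta_oo / z
    = (delta - - z) / delta + (- z - delta_oo) / - z by field; lra.
  have z0 : z < 0 by lra.
  rewrite ger0_norm; last by rewrite addr_ge0 ?divr_ge0; lra.
  apply: ler_wpDr => //.
  have -> : (delta - delta_oo) / delta_oo =
     (delta - - z) / delta_oo + (- z - delta_oo) / delta_oo by ring.
  apply: lerD; apply: ler_wpM2l; rewrite ?lef_pV2 ?posrE; lra.
- have -> : (z + 2 * delta) / delta - (z + 2 * delta_oo) / delta_oo
    = (delta - delta_oo) * (- z / (delta_oo * delta)) by field; lra.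
  apply: ler_wpDl => //.
  rewrite normrM ger0_norm //; apply: ler_wpM2l => //.
  rewrite normrM normrN; apply: ler_wpM2l => //.
  rewrite ger0_norm; last by rewrite invr_ge0 mulr_ge0 // ltW.
  by rewrite lef_pV2 ?posrE ?mulr_gt0 ?exprn_gt0 // expr2; nra.
Qed.

End Barrier.

(** * Euclidean geometry *)

Section Dot.
Context {R : realType} {d : nat}.
Implicit Types u v w x y : 'rV[R]_d.

Lemma dotC u v : dot u v = dot v u.
Proof. by apply: eq_bigr => k _; rewrite mulrC. Qed.

Lemma dotDl u v w : dot (u + v) w = dot u w + dot v w.
Proof. by rewrite /dot -big_split; apply: eq_bigr => k _; rewrite mxE mulrDl. Qed.

Lemma dotZl c u v : dot (c *: u) v = c * dot u v.
Proof. by rewrite /dot mulr_sumr; apply: eq_bigr => k _; rewrite mxE mulrA. Qed.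

Lemma dotDr u v w : dot u (v + w) = dot u v + dot u w.
Proof. by rewrite !(dotC u) dotDl. Qed.

Lemma dotZr c u v : dot u (c *: v) = c * dot u v.
Proof. by rewrite !(dotC u) dotZl. Qed.

Lemma dotNl u v : dot (- u) v = - dot u v.
Proof. by rewrite -scaleN1r dotZl mulN1r. Qed.

Lemma dotNr u v : dot u (- v) = - dot u v.
Proof. by rewrite -scaleN1r dotZr mulN1r. Qed.

Definition dotE := (dotDl, dotDr, dotNl, dotNr, dotZl, dotZr).

Lemma dot0l v : dot 0 v = 0.
Proof. by rewrite -(scale0r 0) dotZl mul0r. Qed.

Lemma dot_suml (I : finType) (F : I -> 'rV[R]_d) v :
  dot (\sum_i F i) v = \sum_i dot (F i) v.
Proof.
by apply: (big_morph (fun u => dot u v)) => [u w|]; rewrite ?dotDl ?dot0l.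
Qed.

Lemma dot_ge0 u : 0 <= dot u u.
Proof. by apply: sumr_ge0 => k _; rewrite -expr2 sqr_ge0. Qed.

Lemma coord_sqr_le_dot u k : (u 0 k) ^+ 2 <= dot u u.
Proof.
rewrite /dot (bigD1 k) //= -expr2 lerDl.
by apply: sumr_ge0 => i _; rewrite -expr2 sqr_ge0.
Qed.

Lemma dot_eq0 u : dot u u <= 0 -> u = 0.
Proof.
move=> u0; apply/rowP => k; rewrite mxE; apply/eqP; rewrite -sqrf_eq0.
by rewrite eq_le sqr_ge0 andbT (le_trans (coord_sqr_le_dot u k)).
Qed.

(** Cauchy-Schwarz, from expanding the square of [dot v v *: u - dot u v *: v] and cancelling powers
    of [dot v v]. *)
Lemma dot_sqr_le u v : dot u v ^+ 2 <= dot u u * dot v v.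
Proof.
have [v0|v0] := lerP (dot v v) 0.
  by rewrite (dot_eq0 _ v0) dotC dot0l expr0n /= dot0l mulr0.
have := dot_ge0 (dot v v *: u - dot u v *: v).
rewrite !dotE (dotC v u) -(pmulr_rge0 _ v0) => h; rewrite -subr_ge0.
rewrite -(pmulr_rge0 _ v0) -(pmulr_rge0 _ v0).
by apply: le_trans h _; rewrite le_eqVlt; apply/orP; left; apply/eqP; ring.
Qed.

Lemma dot_young u v c : 0 < c -> `|dot u v| <= (dot u u / c + c * dot v v) / 2.
Proof.
move=> c0.
have p1 := dot_ge0 (c^-1 *: u + v); have p2 := dot_ge0 (c^-1 *: u - v).
rewrite !dotE in p1 p2; rewrite !(dotC v u) in p1 p2.
have q1 : 0 <= c * (c^-1 * (c^-1 * dot u u) + c^-1 * dot u v + (c^-1 * dot u v + dot v v)).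
  by rewrite mulr_ge0 // ltW.
have q2 : 0 <= c * (c^-1 * (c^-1 * dot u u) - c^-1 * dot u v + (- (c^-1 * dot u v) + dot v v)).
  by apply: mulr_ge0; [exact: ltW|lra].
have e1 : c * (c^-1 * (c^-1 * dot u u) + c^-1 * dot u v + (c^-1 * dot u v + dot v v))
  = dot u u / c + 2 * dot u v + c * dot v v by field; lra.
have e2 : c * (c^-1 * (c^-1 * dot u u) - c^-1 * dot u v + (- (c^-1 * dot u v) + dot v v))
  = dot u u / c - 2 * dot u v + c * dot v v by field; lra.
rewrite ler_norml; apply/andP; split; lra.
Qed.

Lemma dotD_le u v : dot (u + v) (u + v) <= 2 * dot u u + 2 * dot v v.
Proof.
have := dot_ge0 (u - v); rewrite !dotE (dotC v u); lra.
Qed.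

End Dot.

(** * Comparison of the Euclidean norm with the sup norm *)

Section DotTopology.
Context {R : realType} {d : nat}.
Implicit Types u v x y : 'rV[R]_d.+1.

Lemma normr_le_dot u r : 0 <= r -> dot u u <= r ^+ 2 -> `|u| <= r.
Proof.
move=> r0 ur; rewrite [leLHS]/Num.Def.normr/= mx_normrE.
apply/bigmax_leP; split=> // -[i k] _ /=; rewrite ord1.
rewrite -ler_sqr ?nnegrE // real_normK ?num_real //.
exact: le_trans (coord_sqr_le_dot u k) ur.
Qed.

Lemma coord_le_normr u k : `|u 0 k| <= `|u|.
Proof.
rewrite [leRHS]/Num.Def.normr/= mx_normrE.
by apply/bigmax_geP; right => /=; exists (0, k).
Qed.

Lemma dot_le_normr u v : `|dot u v| <= (\sum_k `|u 0 k|) * `|v|.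
Proof.
rewrite mulr_suml; apply: (le_trans (ler_norm_sum _ _ _)).
apply: ler_sum => k _; rewrite normrM; apply: ler_wpM2l => //.
exact: coord_le_normr.
Qed.

Lemma dot_sqr_le_normr u : dot u u <= d.+1%:R * `|u| ^+ 2.
Proof.
apply: (@le_trans _ _ (\sum_(k < d.+1) `|u| ^+ 2)).
  apply: ler_sum => k _; rewrite -expr2 -real_normK ?num_real // ler_sqr ?nnegrE //.
  exact: coord_le_normr.
by rewrite sumr_const card_ord -[leLHS]mulr_natl.
Qed.

Lemma cvg_of_dot (u : nat -> 'rV[R]_d.+1) x :
  (forall e, 0 < e -> \forall k \near \oo, dot (u k - x) (u k - x) < e) ->
  u @ \oo --> x.
Proof.
move=> h; apply/cvgrPdist_le => e e0.
have e20 : 0 < e ^+ 2 by rewrite exprn_gt0.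
have := h _ e20; apply: filterS => k hk.
by rewrite distrC; apply: normr_le_dot; exact: ltW.
Qed.

End DotTopology.

(** * Convex functions with quadratic upper bounds *)

Section SmoothConvex.
Context {R : realType} {d : nat}.
Implicit Types (F : 'rV[R]_d.+1 -> R) (G : 'rV[R]_d.+1 -> 'rV[R]_d.+1).

(** Strong convexity and smoothness without the usual factors 1/2: [mu] and [K] are half the
    customary constants. [G] is a candidate gradient, identified with [grad F] by
    [sandwiched_grad]. *)
Definition sandwiched F G (mu K : R) := forall x y,
  mu * dot (y - x) (y - x) <= F y - F x - dot (G x) (y - x)
    <= K * dot (y - x) (y - x).

(** Along a coordinate vector both bounds are O(h^2), so the difference quotient is within [|h| * C]
    of the coordinate of [G x]. *)
Lemma sandwiched_grad F G mu K x : sandwiched F G mu K -> grad F x = G x.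
Proof.
move=> FG; apply/rowP => k; rewrite mxE /derive.
set v : 'rV[R]_d.+1 := delta_mx 0 k.
pose C := (`|mu| + `|K|) * dot v v.
have vE : dot (G x) v = G x 0 k.
  rewrite /dot (bigD1 k) //= mxE !eqxx mulr1 big1 ?addr0 // => i ik.
  by rewrite mxE (negbTE ik) andbF mulr0.
apply: (@cvg_lim R) => //; apply/cvgrPdist_le => e e0.
have C0 : 0 <= C by rewrite mulr_ge0 ?dot_ge0 // addr_ge0.
near=> h.
have h0 : h != 0 by near: h; exact: nbhs_dnbhs_neq.
have hC : `|h| * C <= e.
  have : `|h| <= e / (C + 1).
    near: h; apply: dnbhs0_le; rewrite divr_gt0 //; lra.
  rewrite ler_pdivlMr; last lra.
  by apply: le_trans; rewrite mulrDr lerDl mulr1.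
have := FG x (h *: v + x); rewrite addrK !dotE => /andP[l u].
have -> : G x 0 k - h^-1 *: (F (h *: v + x) - F x) =
    - h^-1 * (F (h *: v + x) - F x - h * dot (G x) v).
  rewrite vE; change (G x 0 k - h^-1 * (F (h *: v + x) - F x)
    = - h^-1 * (F (h *: v + x) - F x - h * G x 0 k)).
  by field.
rewrite normrM normrN normfV -(ler_pM2l (_ : 0 < `|h|)) ?normr_gt0 //.
rewrite mulrA divff ?normr_eq0 // mul1r.
apply: (@le_trans _ _ (`|h| * (`|h| * C))); last by apply: ler_wpM2l.
have -> : `|h| * (`|h| * C) = (`|mu| + `|K|) * (h * (h * dot v v)).
  by rewrite /C mulrA -expr2 real_normK ?num_real //; ring.
have hv : 0 <= h * (h * dot v v).
  by rewrite mulrA -expr2 mulr_ge0 ?sqr_ge0 ?dot_ge0.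
have m1 := ler_norm K; have m2 := ler_norm (- mu); rewrite normrN in m2.
have m3 := normr_ge0 K; have m4 := normr_ge0 mu.
rewrite ler_norml; apply/andP; split.
  by apply: le_trans l; rewrite -mulNr; apply: ler_wpM2r; lra.
by apply: le_trans u _; apply: ler_wpM2r; lra.
Unshelve. all: by end_near.
Qed.

Lemma sandwiched_lip F G K x y : 0 < K -> sandwiched F G 0 K ->
  dot (G y - G x) (G y - G x) <= (2 * K) ^+ 2 * dot (y - x) (y - x).
Proof.
move=> K0 FG; have [u uD] : {u | u = G y - G x} by exists (G y - G x).
have [w wD] : {w | w = y - x} by exists (y - x).
rewrite -uD -wD.
(* Minimize over [z] the gap between the upper model at [y] and the lower model
   at [x]. *)
pose z := y - (2 * K)^-1 *: u.
have zy : z - y = - ((2 * K)^-1 *: u) by rewrite /z addrC addKr.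
have zx : z - x = w - (2 * K)^-1 *: u by rewrite wD /z addrAC.
have /andP[_ h1] := FG y z.
have /andP[h2 _] := FG x z.
have /andP[_ h3] := FG x y.
rewrite zy in h1; rewrite zx mul0r in h2; rewrite -wD in h3.
have uE : dot (G y) u = dot (G x) u + dot u u.
  by rewrite -dotDl; congr dot; rewrite uD addrC subrK.
have K0' : K != 0 by lra.
move: h1 h2 h3; rewrite !dotE uE.
have e1 : K * - - ((2 * K)^-1 * ((2 * K)^-1 * dot u u)) = (4 * K)^-1 * dot u u by field.
have e2 : (2 * K)^-1 * (dot (G x) u + dot u u) =
    (2 * K)^-1 * dot (G x) u + 2 * ((4 * K)^-1 * dot u u) by field.
rewrite e1 e2 => h1 h2 h3.
have h4 : (4 * K)^-1 * dot u u <= K * dot w w.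
  by lra.
have -> : dot u u = (4 * K) * ((4 * K)^-1 * dot u u) by field.
have -> : (2 * K) ^+ 2 * dot w w = 4 * K * (K * dot w w) by ring.
by rewrite ler_pM2l //; lra.
Qed.

Lemma sandwiched_continuous F G mu K : sandwiched F G mu K -> continuous F.
Proof.
move=> FG x; apply/(@cvgrPdist_le R R _ (nbhs x) (nbhs_filter x) F (F x)) => e e0.
pose C := (\sum_k `|G x 0 k|) + (`|mu| + `|K|) * d.+1%:R.
have C0 : 0 <= C by rewrite addr_ge0 ?sumr_ge0 ?mulr_ge0 ?addr_ge0.
have C1 : 0 < C + 1 by lra.
near=> y; rewrite distrC.
have yx : `|y - x| <= Num.min 1 (e / (C + 1)).
  rewrite distrC; near: y; apply: cvgr_dist_le; first exact: cvg_id.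
  by rewrite lt_min ltr01 divr_gt0.
move: yx; rewrite le_min ler_pdivlMr // => /andP[y1 yC].
apply: (le_trans _ yC).
have /andP[l u] := FG x y.
have t1 := dot_le_normr (G x) (y - x).
have t2 := dot_sqr_le_normr (y - x).
have t3 : `|y - x| ^+ 2 <= `|y - x| by rewrite expr2 ler_piMl.
have m1 := ler_norm K; have m2 := ler_norm (- mu); rewrite normrN in m2.
have m3 := normr_ge0 K; have m4 := normr_ge0 mu.
have d0 := dot_ge0 (y - x).
have t4 : (`|mu| + `|K|) * dot (y - x) (y - x) <= (`|mu| + `|K|) * d.+1%:R * `|y - x|.
  rewrite -mulrA; apply: ler_wpM2l; first lra.
  by apply: le_trans t2 _; apply: ler_wpM2l.
have b1 : F y - F x - dot (G x) (y - x) <= (`|mu| + `|K|) * dot (y - x) (y - x).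
  by apply: le_trans u _; apply: ler_wpM2r => //; lra.
have b2 : - ((`|mu| + `|K|) * dot (y - x) (y - x)) <= F y - F x - dot (G x) (y - x).
  by apply: le_trans l; rewrite -mulNr; apply: ler_wpM2r => //; lra.
have -> : `|y - x| * (C + 1) = (\sum_k `|G x 0 k|) * `|y - x|
   + (`|mu| + `|K|) * d.+1%:R * `|y - x| + `|y - x| by rewrite /C; ring.
have n0 := normr_ge0 (y - x).
rewrite ler_norml in t1; move/andP : t1 => [t1 t1'].
rewrite ler_norml; apply/andP; split; lra.
Unshelve. all: by end_near.
Qed.

(** The lower bound makes a sublevel set bounded, hence compact, so a minimizer exists. A gradient
    step there would decrease [F] unless [G] vanishes, and then the lower bound with [mu > 0] gives
    uniqueness. *)
Lemma sandwiched_argmin F G mu K : 0 < mu -> sandwiched F G mu K ->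
  exists xstar, argmin F = [set xstar] /\ G xstar = 0.
Proof.
move=> mu0 FG; have Fc := sandwiched_continuous _ _ _ _ FG.
pose A : set 'rV[R]_d.+1 := [set x | F x <= F 0].
have Ab : bounded_set A.
  (* From [mu |x|^2 <= - dot (G 0) x] and Young's inequality with weight [mu], which absorbs half of
     the left side. It bounds [|x|^2]; as [M > r + 1], also [r <= M^2]. *)
  pose r := dot (G 0) (G 0) / mu ^+ 2.
  have r0 : 0 <= r by rewrite divr_ge0 ?dot_ge0 ?sqr_ge0.
  exists (r + 1); split; first exact: num_real.
  move=> M Mr x /= Ax; apply: normr_le_dot; first lra.
  have /andP[l _] := FG 0 x; rewrite subr0 in l.
  have := dot_young (G 0) x _ mu0; rewrite ler_norml => /andP[y _].
  have : mu * dot x x <= mu * r.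
    have -> : mu * r = dot (G 0) (G 0) / mu by rewrite /r; field; lra.
    by move: Ax; rewrite /A /=; lra.
  rewrite ler_pM2l // => /le_trans; apply.
  by rewrite expr2; nra.
have Acl : closed A.
  have -> : A = F @^-1` [set z | z <= F 0] by [].
  by apply: preimage_closed; [move=> x _; exact: Fc|exact: closed_le].
have [] := compact_EVT_min (f := F) (ex_intro _ 0 (lexx _) : A !=set0)
  (bounded_closed_compact Ab Acl) (continuous_subspaceT Fc).
move=> xs _ xsmin.
have xs_min y : F xs <= F y.
  have [Ay|Ay] := pselect (A y); first by apply: xsmin; rewrite inE.
  have A0 : A 0 by rewrite /A /=.
  apply: (le_trans (xsmin 0 _)); first by rewrite inE.
  by move/negP : Ay; rewrite -ltNge => /ltW.
pose C := `|K| + 1; have C0 : 0 < C by rewrite /C; have := normr_ge0 K; lra.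
have KC : K <= C by rewrite /C; have := ler_norm K; lra.
have G0 : G xs = 0.
  apply: dot_eq0.
  (* This step minimizes the upper model [dot (G xs) u + C |u|^2], with value
     [- |G xs|^2 / (4 C)]. *)
  pose u := - ((2 * C)^-1 *: G xs).
  have /andP[_] := FG xs (u + xs); rewrite addrK => h.
  have h1 := xs_min (u + xs).
  have h2 : K * dot u u <= C * dot u u by apply: ler_wpM2r => //; exact: dot_ge0.
  have h3 : 0 <= dot (G xs) u + C * dot u u by lra.
  move: h3; rewrite /u !dotE.
  have -> : - ((2 * C)^-1 * dot (G xs) (G xs))
    + C * - - ((2 * C)^-1 * ((2 * C)^-1 * dot (G xs) (G xs)))
    = - ((4 * C)^-1 * dot (G xs) (G xs)) by field; lra.
  by rewrite oppr_ge0 pmulr_rle0 // invr_gt0; lra.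
exists xs; split=> //; apply/seteqP; split=> [y /= ymin|_ /= -> //].
have /andP[l _] := FG xs y; rewrite G0 dot0l in l.
have : y - xs = 0.
  by apply: dot_eq0; rewrite -(pmulr_rle0 _ mu0); have := ymin xs; lra.
by move/eqP; rewrite subr_eq0 => /eqP.
Qed.

End SmoothConvex.

(** * Sums, averages and affine compositions of sandwiched functions *)

Section SandwichedOps.
Context {R : realType} {d : nat}.
Implicit Types (F : 'rV[R]_d.+1 -> R) (G : 'rV[R]_d.+1 -> 'rV[R]_d.+1).

Lemma sandwiched_le F G mu K K' : K <= K' ->
  sandwiched F G mu K -> sandwiched F G mu K'.
Proof.
move=> KK h x y; have /andP[-> u] := h x y; apply: (le_trans u).
by apply: ler_wpM2r => //; exact: dot_ge0.
Qed.

Lemma sandwichedD F1 G1 mu1 K1 F2 G2 mu2 K2 :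
  sandwiched F1 G1 mu1 K1 -> sandwiched F2 G2 mu2 K2 ->
  sandwiched (fun x => F1 x + F2 x) (fun x => G1 x + G2 x) (mu1 + mu2) (K1 + K2).
Proof.
move=> h1 h2 x y; have /andP[l1 u1] := h1 x y; have /andP[l2 u2] := h2 x y.
by rewrite dotDl !mulrDl; apply/andP; split; lra.
Qed.

Lemma sandwiched_avg n (F : 'I_n.+1 -> 'rV[R]_d.+1 -> R)
    (G : 'I_n.+1 -> 'rV[R]_d.+1 -> 'rV[R]_d.+1) mu K :
  (forall i, sandwiched (F i) (G i) mu K) ->
  sandwiched (fun x => n.+1%:R^-1 * \sum_i F i x)
             (fun x => n.+1%:R^-1 *: \sum_i G i x) mu K.
Proof.
move=> h x y; rewrite dotZl dot_suml -!mulrBr -!sumrB.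
have n0 : 0 < n.+1%:R :> R by rewrite ltr0n.
have avg (c : R) : c = n.+1%:R^-1 * \sum_(i < n.+1) c.
  by rewrite sumr_const card_ord -(mulr_natl c) mulKf // gt_eqF.
rewrite (avg (mu * _)) (avg (K * _)) !ler_pM2l ?invr_gt0 //.
by apply/andP; split; apply: ler_sum => i _; have /andP[] := h i x y.
Qed.

(** Add the lower bounds based at [x] and at [y]: the function values cancel. *)
Lemma sandwiched_monotone F G mu K x y : sandwiched F G mu K ->
  2 * mu * dot (x - y) (x - y) <= dot (G x - G y) (x - y).
Proof.
move=> h; have /andP[l1 _] := h x y; have /andP[l2 _] := h y x.
move: l1; rewrite -[y - x]opprB dotNl !dotNr => l1.
by rewrite dotDl dotNl; lra.
Qed.

Lemma barrier_sandwiched (a : 'rV[R]_d.+1) b delta : 0 < delta ->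
  sandwiched (fun x => relaxed_barrier (dot a x + b) delta)
    (fun x => dbarrier (dot a x + b) delta *: a) 0 (dot a a / delta).
Proof.
move=> d0 x y; rewrite mul0r dotZl.
have e : dot a (y - x) = (dot a y + b) - (dot a x + b) by rewrite dotDr dotNr; ring.
have /andP[l u] := bregman_bound (dot a x + b) (dot a y + b) _ d0.
rewrite e; apply/andP; split=> //; apply: (le_trans u).
rewrite -e [leRHS]mulrAC; apply: ler_wpM2r; first by rewrite invr_ge0 ltW.
exact: dot_sqr_le.
Qed.

End SandwichedOps.

(** * Markov chains driven by uniform independent draws *)

Section UniformChain.
Context {R : realType} {disp : measure_display} {T : measurableType disp}.
Variable P : probability T R.
Context {A : finType} {S : Type}.
(* [q] is the probability of each of the [#|A|] letters drawn by [r k]. *)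
Variables (q : R) (r : nat -> T -> A).
Variables (Phi : nat -> S -> A -> S) (x0 : S) (X : nat -> T -> S).

(** [p] is an infinite word of which only the first [k] letters count, so cylinders of all lengths
    share one index type. *)
Definition cyl k (p : nat -> A) : set T := [set w | forall l, (l < k)%N -> r l w = p l].

Definition upd (p : nat -> A) k a : nat -> A := fun l => if l == k then a else p l.

(* [mean k N phi x] is the expectation of [phi (X (k + N))] given [X k = x]. *)
Definition mean k N (phi : S -> R) (x : S) : R :=
  (fix mean N k x := if N is N'.+1 then q * \sum_a mean N' k.+1 (Phi k x a)
                     else phi x) N k x.

(** The time window is finite to allow induction on [M]; the limit in [M] is taken in [ville]. *)
Definition hit (phi : nat -> S -> R) lam k M : set T :=
  [set w | exists l, (k <= l <= k + M)%N /\ lam <= phi l (X l w)].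

Hypothesis q_unit : q * #|A|%:R = 1.
Hypothesis q_ge0 : 0 <= q.
Hypothesis measurable_r : forall k a, measurable (r k @^-1` [set a]).
Hypothesis Pcyl : forall k p, P (cyl k p) = (q ^+ k)%:E.
Hypothesis X0 : forall w, X 0%N w = x0.
Hypothesis XS : forall k w, X k.+1 w = Phi k (X k w) (r k w).

Lemma meanS k N phi x : mean k N.+1 phi x = q * \sum_a mean k.+1 N phi (Phi k x a).
Proof. by []. Qed.

(** [mean] unfolds at the first step; peeling off the last one instead allows a one-step drift bound
    to be applied at time [k + N]. *)
Lemma mean_Sr k N phi x :
  mean k N.+1 phi x = mean k N (fun y => mean (k + N) 1 phi y) x.
Proof.
elim: N k x => [|N IH] k x; first by rewrite addn0.
rewrite meanS [RHS]meanS; congr (_ * _); apply: eq_bigr => a _.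
by rewrite IH addSnnS.
Qed.

Lemma le_mean k N phi psi x : (forall y, phi y <= psi y) ->
  mean k N phi x <= mean k N psi x.
Proof.
move=> h; elim: N k x => [|N IH] k x; first exact: h.
by rewrite !meanS; apply: ler_wpM2l => //; apply: ler_sum => a _.
Qed.

Lemma mean_affine k N phi c t x :
  mean k N (fun y => c * phi y + t) x = c * mean k N phi x + t.
Proof.
elim: N k x => [//|N IH] k x; rewrite !meanS.
under eq_bigr do rewrite IH.
rewrite big_split /= sumr_const -mulr_sumr mulrDr mulrCA; congr (_ + _).
by rewrite -[t *+ _]mulr_natl mulrA q_unit mul1r.
Qed.

Lemma meanB k N phi psi x :
  mean k N (fun y => phi y - psi y) x = mean k N phi x - mean k N psi x.
Proof.
elim: N k x => [//|N IH] k x; rewrite !meanS.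
by under eq_bigr do rewrite IH; rewrite sumrB mulrBr.
Qed.

Lemma mean_ge0 k N phi x : (forall y, 0 <= phi y) -> 0 <= mean k N phi x.
Proof.
move=> h; apply: le_trans (le_mean _ _ (fun y => 0 * phi y + 0) phi x _).
  by rewrite mean_affine mul0r addr0.
by move=> y; rewrite mul0r addr0.
Qed.

(** Any predicate [Q] is allowed because [X k] depends on finitely many draws from a finite
    alphabet: the event is a finite union over the last letter. *)
Lemma measurable_X k (Q : S -> Prop) : measurable [set w | Q (X k w)].
Proof.
elim: k Q => [|k IH] Q.
  have [Qx|Qx] := pselect (Q x0).
    by rewrite (_ : [set w | _] = setT) //; apply/seteqP; split=> w //=; rewrite X0.
  by rewrite (_ : [set w | _] = set0) //; apply/seteqP; split=> w //=; rewrite X0.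
rewrite (_ : [set w | _] =
  \bigcup_(a in [set: A]) ((r k @^-1` [set a]) `&` [set w | Q (Phi k (X k w) a)])).
  apply: fin_bigcup_measurable; first exact: finite_finset.
  move=> a _; apply: measurableI; first exact: measurable_r.
  exact: (IH (fun x => Q (Phi k x a))).
apply/seteqP; split=> w /=; rewrite XS; first by move=> ?; exists (r k w).
by move=> [a _ /= [<-]].
Qed.

Lemma measurable_hit phi lam k M : measurable (hit phi lam k M).
Proof.
rewrite (_ : hit _ _ _ _ =
    \bigcup_(l in [set l | (k <= l <= k + M)%N]) [set w | lam <= phi l (X l w)]).
  by apply: bigcup_measurable => l _; exact: (measurable_X l (fun x => lam <= phi l x)).
apply/seteqP; split=> w; first by move=> [l [? ?]]; exists l.
by move=> [l ? ?]; exists l.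
Qed.

Lemma cyl_recr k p : cyl k.+1 p = cyl k p `&` (r k @^-1` [set p k]).
Proof.
apply/seteqP; split=> w /=; first by
  move=> h; split=> [l lk|]; apply: h => //; exact: ltnW.
by move=> [h e] l; rewrite ltnS leq_eqVlt => /predU1P[->//|]; exact: h.
Qed.

Lemma cyl_upd k p a : cyl k (upd p k a) = cyl k p.
Proof.
by apply/seteqP; split=> w h l lk; rewrite h // /upd ltn_eqF.
Qed.

Lemma measurable_cyl k p : measurable (cyl k p).
Proof.
elim: k => [|k IH]; last by rewrite cyl_recr; exact: measurableI.
by rewrite (_ : cyl 0 p = setT) //; apply/seteqP; split.
Qed.

(** Finite subadditivity over the next letter drawn. *)
Lemma cyl_split k p (H : set T) (c : A -> R) : measurable H ->
  (forall a, (P (cyl k.+1 (upd p k a) `&` H) <= (c a)%:E)%E) ->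
  (P (cyl k p `&` H) <= (\sum_a c a)%:E)%E.
Proof.
move=> mH h; have mI a : measurable (cyl k.+1 (upd p k a) `&` H).
  by apply: measurableI => //; exact: measurable_cyl.
apply: le_trans (content_sub_fsum P (D := [set: A])
  (A_ := fun a => cyl k.+1 (upd p k a) `&` H) _ _ _ _) _ => //.
- exact: finite_finset.
- by apply: measurableI => //; exact: measurable_cyl.
- move=> w [cw Hw]; exists (r k w) => //; split=> //.
  by rewrite cyl_recr cyl_upd; split=> //=; rewrite /upd eqxx.
rewrite (@fsbigE _ _ _ _ _ (index_enum A)) ?index_enum_uniq //; last first.
  by move=> a _; rewrite mem_index_enum.
rewrite (eq_bigl xpredT) => [|a]; last by rewrite in_setT.
by rewrite -sumEFin; apply: lee_sum => a _; exact: h.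
Qed.

(** * Ville's maximal inequality *)

Section Ville.
Variables (phi : nat -> S -> R) (lam : R).
Hypothesis lam_gt0 : 0 < lam.
Hypothesis phi_ge0 : forall k x, 0 <= phi k x.
Hypothesis phi_super : forall k x, mean k 1 (phi k.+1) x <= phi k x.

(** The state at time [k] is constant on the cylinder. If [phi k x >= lam], the bound exceeds the
    probability of the cylinder. Otherwise a hit must come later: split by the next letter, use
    induction on [M], and average by [phi_super]. *)
Lemma ville_cyl M k p x : (forall w, cyl k p w -> X k w = x) ->
  (P (cyl k p `&` hit phi lam k M) <= (q ^+ k * (phi k x / lam))%:E)%E.
Proof.
elim: M k p x => [|M IH] k p x cx.
all: have [lx|xl] := lerP lam (phi k x).
1, 3: apply: (@le_trans _ _ (P (cyl k p)));
  [apply: le_measure; rewrite ?inE; [apply: measurableI|..];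
   try exact: measurable_cyl; try exact: measurable_hit; by move=> w []
  |rewrite Pcyl lee_fin ler_peMr ?exprn_ge0 // ler_pdivlMr //; lra].
  rewrite (_ : _ `&` _ = set0) ?measure0 ?lee_fin ?mulr_ge0 ?exprn_ge0 ?invr_ge0 ?(ltW lam_gt0) //.
  apply/seteqP; split=> // w [cw [l []]]; rewrite addn0 -eqn_leq => /eqP <-.
  by rewrite cx // leNgt xl.
apply: (@le_trans _ _ (P (cyl k p `&` hit phi lam k.+1 M))).
  apply: le_measure; rewrite ?inE; try apply: measurableI;
    try exact: measurable_cyl; try exact: measurable_hit.
  move=> w [cw [l [/andP[kl lM] hl]]]; split=> //; exists l; split=> //.
  rewrite addSnnS lM andbT ltn_neqAle kl andbT; apply/eqP => kE.
  by move: hl; rewrite -kE cx // leNgt xl.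
have st a w : cyl k.+1 (upd p k a) w -> X k.+1 w = Phi k x a.
  by rewrite cyl_recr cyl_upd XS => -[/cx -> /= ->]; rewrite /upd eqxx.
apply: le_trans (cyl_split _ _ _ _ (measurable_hit _ _ _ _) (fun a => IH _ _ _ (st a))) _.
rewrite lee_fin -mulr_sumr -mulr_suml exprSr -mulrA; apply: ler_wpM2l.
  exact: exprn_ge0.
by rewrite mulrA ler_wpM2r ?invr_ge0 ?(ltW lam_gt0) //; exact: phi_super.
Qed.

(** Delaying the window by [N] steps replaces [phi k x] by a mean at time [k + N], the quantity that
    can be made small. *)
Lemma ville_mean N M k p x : (forall w, cyl k p w -> X k w = x) ->
  (P (cyl k p `&` hit phi lam (k + N) M)
    <= (q ^+ k * (mean k N (phi (k + N)%N) x / lam))%:E)%E.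
Proof.
elim: N k p x => [|N IH] k p x cx; first by rewrite addn0; exact: ville_cyl.
have st a w : cyl k.+1 (upd p k a) w -> X k.+1 w = Phi k x a.
  by rewrite cyl_recr cyl_upd XS => -[/cx -> /= ->]; rewrite /upd eqxx.
rewrite -addSnnS.
apply: le_trans (cyl_split _ _ _ _ (measurable_hit _ _ _ _) (fun a => IH _ _ _ (st a))) _.
by rewrite lee_fin -mulr_sumr -mulr_suml exprSr meanS !mulrA.
Qed.

Lemma ville N : (P (\bigcup_M hit phi lam N M) <= (mean 0 N (phi N) x0 / lam)%:E)%E.
Proof.
have mh M := measurable_hit phi lam N M.
have ndh : {homo hit phi lam N : i j / (i <= j)%N >-> (i <= j)%O}.
  move=> i j ij; apply/subsetPset => w [l [/andP[Nl li] hl]]; exists l; split=> //.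
  by rewrite Nl (leq_trans li) // leq_add2l.
have cv := nondecreasing_cvg_mu (mu := P) mh (bigcup_measurable (fun k _ => mh k)) ndh.
apply: (cvge_le _ cv); apply: nearW => M /=.
(* Some word is needed to name the cylinder of length 0, which is the whole space; the draws at any
   sample point provide one. *)
have [p _] : exists p : nat -> A, True.
  have [w _] : exists w : T, True by exists point.
  by exists (r ^~ w).
have := ville_mean N M 0 p x0; rewrite add0n expr0 mul1r.
rewrite (_ : cyl 0 p = setT) ?setTI; last by apply/seteqP; split.
by apply=> w _; exact: X0.
Qed.

End Ville.

(** For each threshold [1 / (i + 1)], the event [bad i] of hits at arbitrarily late times lies in
    every tail event, and [ville] makes the probabilities of these arbitrarily small. *)
Lemma ville_negligible (phi : nat -> S -> R) :
  (forall k x, 0 <= phi k x) ->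
  (forall k x, mean k 1 (phi k.+1) x <= phi k x) ->
  (forall eta, 0 < eta -> exists N, mean 0 N (phi N) x0 < eta) ->
  {ae P, forall w, forall lam, 0 < lam ->
     \forall k \near \oo, phi k (X k w) < lam}.
Proof.
move=> phi0 phiS phi_small.
pose bad i := \bigcap_N \bigcup_M hit phi i.+1%:R^-1 N M.
have mbad i : measurable (bad i).
  apply: bigcap_measurable => [|N _]; first by exists 0%N.
  by apply: bigcup_measurable => M _; exact: measurable_hit.
have bad0 i : P.-negligible (bad i).
  exists (bad i); split => //; apply/eqP; rewrite eq_le measure_ge0 andbT.
  apply/lee_addgt0Pr => e e0; rewrite add0e.
  have i0 : 0 < i.+1%:R^-1 :> R by rewrite invr_gt0 ltr0n.
  have [N hN] := phi_small (e * i.+1%:R^-1) (mulr_gt0 e0 i0).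
  apply: (@le_trans _ _ (P (\bigcup_M hit phi i.+1%:R^-1 N M))).
    apply: le_measure; rewrite ?inE //; last by move=> w /(_ N I).
    by apply: bigcup_measurable => M _; exact: measurable_hit.
  apply: le_trans (ville phi _ i0 phi0 phiS N) _.
  by rewrite lee_fin ler_pdivrMr // ltW.
apply: negligibleS (negligible_bigcup bad0) => w /= nw.
apply: contrapT => nb; apply: nw => lam lam0.
have [i hi] : exists i : nat, i.+1%:R^-1 < lam.
  have [N _ hN] := near_infty_natSinv_lt (PosNum lam0).
  by exists N; apply: hN => /=.
have nbi : ~ bad i w by move=> bi; apply: nb; exists i.
have [N hN] : exists N, ~ (\bigcup_M hit phi i.+1%:R^-1 N M) w.
  apply: contrapT => h; apply: nbi => N _; apply: contrapT => h'.
  by apply: h; exists N.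
exists N => // k /= Nk; apply: le_lt_trans hi.
rewrite leNgt; apply/negP => hk; apply: hN; exists (k - N)%N => //.
by exists k; rewrite subnKC // Nk leqnn; split=> //; exact: ltW.
Qed.

(** * Almost sure convergence from a drift inequality *)

Section RobbinsSiegmund.
Variables (V : S -> R) (beta gamma : nat -> R) (c B : R).
Hypothesis V_ge0 : forall x, 0 <= V x.
Hypothesis beta_ge0 : forall k, 0 <= beta k.
Hypothesis beta_sum : forall k, \sum_(l < k) beta l <= B.
Hypothesis gamma_ge0 : forall k, 0 <= gamma k.
Hypothesis gamma_sum : forall M, exists k, M < \sum_(l < k) gamma l.
Hypothesis c_gt0 : 0 < c.
Hypothesis V_drift : forall k x,
  mean k 1 V x <= (1 + beta k - c * gamma k) * V x + beta k.

Let b k := \sum_(l < k) beta l.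

Let b_le k l : (k <= l)%N -> b k <= b l.
Proof.
move=> kl; rewrite -(subnKC kl) /b big_split_ord /= lerDl.
by apply: sumr_ge0.
Qed.

(* The weights [expR (- b k)] absorb the factors [1 + beta k], and adding the tails
   [s - b k] absorbs the additive errors. *)
Lemma robbins_siegmund : {ae P, forall w, forall lam, 0 < lam ->
  \forall k \near \oo, V (X k w) < lam}.
Proof.
pose E : set R := range b.
have Esup : has_sup E.
  by split; [exists (b 0%N), 0%N|exists B => _ [k _ <-]; exact: beta_sum].
(* [s] is the full sum of [beta], so [t k] below is its tail from [k] on. *)
pose s := sup E.
have b_s k : b k <= s by apply: sup_upper_bound => //; exists k.
pose t k := s - b k.
pose p k := expR (- b k).
have p_ge k : expR (- s) <= p k by rewrite ler_expR lerN2.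
have c0 : 0 < expR (- s) by exact: expR_gt0.
have p_gt0 k : 0 < p k by exact: expR_gt0.
have b0 k : 0 <= b k by apply: sumr_ge0.
have p_le1 k : p k <= 1 by rewrite -expR0 ler_expR oppr_le0.
have pS k : p k.+1 * (1 + beta k) <= p k.
  have -> : p k = p k.+1 * expR (beta k).
    by rewrite /p -expRD /b big_ord_recr /= opprD addrNK.
  by rewrite ler_pM2l // expR_ge1Dx.
pose phi k x := p k * V x + t k.
have drift k x : mean k 1 (phi k.+1) x <= phi k x - expR (- s) * (c * gamma k) * V x.
  rewrite mean_affine /phi.
  have h1 := ler_wpM2l (ltW (p_gt0 k.+1)) (V_drift k x).
  have h2 := ler_wpM2r (V_ge0 x) (pS k).
  have h3 : p k.+1 * beta k <= beta k by rewrite ler_piMl.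
  have h4 : expR (- s) * (c * gamma k * V x) <= p k.+1 * (c * gamma k * V x).
    by apply: ler_wpM2r => //; rewrite !mulr_ge0 // ltW.
  have h5 : t k = t k.+1 + beta k by rewrite /t /b big_ord_recr /=; ring.
  rewrite h5; lra.
have phi0 k x : 0 <= phi k x.
  by rewrite addr_ge0 ?subr_ge0 // mulr_ge0 // ltW.
have dr0 k x : 0 <= expR (- s) * (c * gamma k) * V x.
  by rewrite !mulr_ge0 // ltW.
have phiS k x : mean k 1 (phi k.+1) x <= phi k x.
  by apply: le_trans (drift k x) _; rewrite gerBl.
(* By contradiction: if the means [u k] of [phi k] stay above [eta] while the tail [t k] is below
   [eta / 2], the mean of [V] is at least [eta / 2]. Then [u] drops by [D * gamma k] at each step,
   and the divergence of the sum of [gamma] drives it below 0. *)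
have phi_small eta : 0 < eta -> exists N, mean 0 N (phi N) x0 < eta.
  move=> eta0; apply: contrapT => hN.
  have {}hN N : eta <= mean 0 N (phi N) x0.
    by rewrite leNgt; apply/negP => ?; apply: hN; exists N.
  have eta2 : 0 < eta / 2 by lra.
  have [_ [K _ <-] hK] := sup_adherent eta2 Esup.
  pose u k := mean 0 k (phi k) x0.
  pose D := expR (- s) * c * (eta / 2).
  have D0 : 0 < D by rewrite !mulr_gt0.
  have uS k : (K <= k)%N -> u k.+1 <= u k - D * gamma k.
    move=> Kk; rewrite /u mean_Sr add0n.
    apply: le_trans (le_mean _ _ _ _ _ (drift k)) _.
    rewrite meanB lerD2l lerN2.
    have -> : mean 0 k (fun y => expR (- s) * (c * gamma k) * V y) x0
        = expR (- s) * (c * gamma k) * mean 0 k V x0.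
      have := mean_affine 0 k V (expR (- s) * (c * gamma k)) 0 x0.
      by rewrite addr0; under [X in mean _ _ X]eq_fun do rewrite addr0.
    have e0 : 0 <= mean 0 k V x0 by exact: mean_ge0.
    have e1 : eta / 2 <= mean 0 k V x0.
      have := hN k; rewrite mean_affine => h.
      have tk : t k < eta / 2.
        by have := b_le _ _ Kk; rewrite /t; move: hK; rewrite -/s; lra.
      have : p k * mean 0 k V x0 <= mean 0 k V x0 by rewrite ler_piMl.
      lra.
    have -> : D * gamma k = expR (- s) * (c * gamma k) * (eta / 2) by rewrite /D; ring.
    by apply: ler_wpM2l => //; rewrite !mulr_ge0 // ltW.
  have uK j : u (K + j)%N <= u K - D * (\sum_(l < K + j) gamma l - \sum_(l < K) gamma l).
    elim: j => [|j IH]; first by rewrite addn0 subrr mulr0 subr0.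
    rewrite addnS; apply: le_trans (uS _ (leq_addr _ _)) _.
    by rewrite big_ord_recr /=; lra.
  (* Enough step sizes to exhaust [u K] at rate [D], on top of those spent before [K]. *)
  have [k hk] := gamma_sum (u K / D + \sum_(l < K) gamma l).
  have := uK k; have := hN (K + k)%N; rewrite -/(u _).
  have gk : \sum_(l < k) gamma l <= \sum_(l < K + k) gamma l.
    by rewrite addnC big_split_ord /= lerDl sumr_ge0.
  have : u K < D * (\sum_(l < K + k) gamma l - \sum_(l < K) gamma l).
    by rewrite mulrC -ltr_pdivrMr //; lra.
  lra.
have := ville_negligible phi phi0 phiS phi_small.
apply: filterS => w hw lam lam0.
(* [phi k] dominates [expR (- s) * V], hence the rescaled threshold. *)
have := hw _ (mulr_gt0 c0 lam0); apply: filterS => k hk.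
rewrite -(ltr_pM2l c0); apply: le_lt_trans hk.
have : expR (- s) * V (X k w) <= p k * V (X k w) by apply: ler_wpM2r.
by have := b_s k; rewrite /phi /t; lra.
Qed.

End RobbinsSiegmund.
End UniformChain.

(** * Partial sums of nonnegative series *)

Section Series.
Context {R : realType}.
Variable u : nat -> R.
Hypothesis u_ge0 : forall k, 0 <= u k.

Lemma nneseries_bounded : (\sum_(0 <= k <oo) (u k)%:E < +oo)%E ->
  exists B, forall k, \sum_(l < k) u l <= B.
Proof.
set s := (X in (X < _)%E) => su; exists (fine s) => k.
have s0 : (0 <= s)%E by apply: nneseries_ge0 => i _ _; rewrite lee_fin.
rewrite -lee_fin fineK; last by rewrite ge0_fin_numE.
apply: le_trans (nneseries_lim_ge k _); last by move=> i _ _; rewrite lee_fin.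
by rewrite big_mkord sumEFin.
Qed.

Lemma nneseries_unbounded : (\sum_(0 <= k <oo) (u k)%:E = +oo)%E ->
  forall M, exists k, M < \sum_(l < k) u l.
Proof.
move=> su M; apply: contrapT => h.
have : (\sum_(0 <= k <oo) (u k)%:E <= M%:E)%E.
  apply: lime_le; first by apply: is_cvg_nneseries => i _ _; rewrite lee_fin.
  apply: nearW => k; rewrite big_mkord sumEFin lee_fin leNgt.
  by apply/negP => ?; apply: h; exists k.
by rewrite su leye_eq.
Qed.

End Series.

(** * Cylinder probabilities for the pairs of random indices *)

Section IndependentPairs.
Context {R : realType} {disp : measure_display} {T : measurableType disp}.
Variables (P : probability T R) (n m : nat).
Variables (i_ : nat -> {RV P >-> 'I_n.+1}) (j_ : nat -> {RV P >-> 'I_m.+1}).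

Definition pairs k w := (i_ k w, j_ k w).

Lemma measurable_pairs k a : measurable (pairs k @^-1` [set a]).
Proof.
rewrite (_ : _ @^-1` _ = (i_ k @^-1` [set a.1]) `&` (j_ k @^-1` [set a.2])).
  apply: measurableI; rewrite -[X in measurable X]setTI;
    exact: measurable_funPT.
apply/seteqP; split=> w /=; first by move=> <-.
by case: a => a1 a2 /= [<- <-].
Qed.

(** Built recursively so that the independence product loses exactly one [i_] factor and one [j_]
    factor at each step of the induction on [k]. *)
Fixpoint indices k : {fset nat + nat} :=
  if k is k'.+1 then (inl k' |` (inr k' |` indices k'))%fset else fset0.

Lemma mem_indices k s :
  (s \in indices k) = match s with inl l => (l < k)%N | inr l => (l < k)%N end.
Proof.
elim: k s => [|k IH] s; first by rewrite inE; case: s.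
by rewrite /= !inE IH; case: s => l /=; rewrite ltnS [RHS]leq_eqVlt.
Qed.

Hypothesis indep : independent_sigma_algebras P
  (fun s : nat + nat => match s with
                        | inl k => sigma_of (i_ k)
                        | inr k => sigma_of (j_ k)
                        end).
Hypothesis i_unif : forall k, uniform_on_ord P (i_ k).
Hypothesis j_unif : forall k, uniform_on_ord P (j_ k).

Lemma P_cyl_pairs k p :
  P (cyl pairs k p) = (((n.+1%:R * m.+1%:R)^-1) ^+ k)%:E.
Proof.
pose A (s : nat + nat) := match s with
  | inl l => i_ l @^-1` [set (p l).1] | inr l => j_ l @^-1` [set (p l).2] end.
have -> : cyl pairs k p = \bigcap_(s in [set` indices k]) A s.
  apply/seteqP; split=> w /= h.
    by move=> [l|l] /=; rewrite mem_indices => /h <-.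
  move=> l lk; rewrite [RHS]surjective_pairing /pairs.
  have := h (inl l); have := h (inr l); rewrite /= !mem_indices.
  by move=> /(_ lk) -> /(_ lk) ->.
rewrite indep; last first.
  by move=> [l|l] _; [exists [set (p l).1]|exists [set (p l).2]]; rewrite ?setTI.
elim: k => [|k IH]; first by rewrite big_seq_fset0.
have ik : inl k \notin (inr k |` indices k)%fset by rewrite !inE mem_indices ltnn.
have jk : inr k \notin indices k by rewrite mem_indices ltnn.
rewrite (big_fsetU1 _ _ ik) (big_fsetU1 _ _ jk) /= IH i_unif j_unif -!EFinM.
by rewrite exprS invfM mulrA.
Qed.

End IndependentPairs.

(** * The stochastic gradient iteration *)

Section Drift.
Context {R : realType} {d n m : nat}.
Local Notation E := 'rV[R]_d.+1.
Variables (fi : 'I_n.+1 -> E -> R) (a : 'I_m.+1 -> E) (b : 'I_m.+1 -> R).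
Variables (f : E -> R) (mu L delta_oo : R).
Hypothesis fE : forall x, f x = n.+1%:R^-1 * \sum_(i < n.+1) fi i x.
Hypothesis mu_gt0 : 0 < mu.
Hypothesis mu_le : mu <= L.
Hypothesis fi_upper : forall i (x y : E), fi i y - fi i x <=
  dot (grad (fi i) x) (y - x) + L / 2 * norm2 (y - x) ^+ 2.
Hypothesis fi_lower : forall i (x y : E),
  fi i y - fi i x >= dot (grad (fi i) x) (y - x).
Hypothesis f_lower : forall (x y : E), f y - f x >=
  dot (grad f x) (y - x) + mu / 2 * norm2 (y - x) ^+ 2.
Hypothesis delta_oo_gt0 : 0 < delta_oo.

Local Notation g j x := (dot (a j) x + b j).

Lemma norm2_sqr (u : E) : norm2 u ^+ 2 = dot u u.
Proof. by rewrite sqr_sqrtr // dot_ge0. Qed.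

Lemma sandwiched_fi i : sandwiched (fi i) (grad (fi i)) 0 (L / 2).
Proof.
move=> x y; have := fi_upper i x y; have := fi_lower i x y.
by rewrite norm2_sqr => l u; apply/andP; split; lra.
Qed.

(** Modulus 0 is enough to identify [grad f] as the average of the [grad (fi i)]; the strong
    convexity assumption, phrased with [grad f], then improves the lower bound in [sandwiched_f]. *)
Lemma sandwiched_f_avg :
  sandwiched f (fun x => n.+1%:R^-1 *: \sum_i grad (fi i) x) 0 (L / 2).
Proof.
rewrite (_ : f = fun x => n.+1%:R^-1 * \sum_i fi i x); last exact/funext.
exact: sandwiched_avg sandwiched_fi.
Qed.

Lemma grad_f x : grad f x = n.+1%:R^-1 *: \sum_i grad (fi i) x.
Proof. exact: sandwiched_grad sandwiched_f_avg. Qed.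

Lemma sandwiched_f : sandwiched f (grad f) (mu / 2) (L / 2).
Proof.
move=> x y; have := f_lower x y; have := sandwiched_f_avg x y.
rewrite /= -grad_f norm2_sqr => /andP[_ u] l; apply/andP; split; lra.
Qed.

(** One constant for all [j] and all [delta >= delta_oo]; the sum over [j] stands in for a
    maximum. *)
Definition barrier_smoothness := (\sum_j dot (a j) (a j)) / delta_oo.

Lemma sandwiched_barrier delta j : delta_oo <= delta ->
  sandwiched (fun x => relaxed_barrier (g j x) delta)
    (fun x => dbarrier (g j x) delta *: a j) 0 barrier_smoothness.
Proof.
move=> dd; have d0 : 0 < delta by exact: lt_le_trans dd.
apply: sandwiched_le (barrier_sandwiched (a j) (b j) _ d0).
apply: (@le_trans _ _ (dot (a j) (a j) / delta_oo)).
  by apply: ler_wpM2l; rewrite ?dot_ge0 // lef_pV2.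
apply: ler_wpM2r; first by rewrite invr_ge0 ltW.
rewrite (bigD1 j) //= lerDl; apply: sumr_ge0 => i _; exact: dot_ge0.
Qed.

Definition penalized delta x :=
  f x + m.+1%:R^-1 * \sum_(j < m.+1) relaxed_barrier (g j x) delta.

Definition penalized_grad delta x :=
  grad f x + m.+1%:R^-1 *: \sum_(j < m.+1) (dbarrier (g j x) delta *: a j).

Lemma sandwiched_penalized delta : delta_oo <= delta ->
  sandwiched (penalized delta) (penalized_grad delta) (mu / 2)
    (L / 2 + barrier_smoothness).
Proof.
move=> dd; have := sandwichedD _ _ _ _ _ _ _ _ sandwiched_f
  (sandwiched_avg _ _ _ _ _ (fun j => sandwiched_barrier _ j dd)).
by rewrite addr0.
Qed.

Definition sample_grad delta x (r : 'I_n.+1 * 'I_m.+1) :=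
  grad (fi r.1) x + dbarrier (g r.2 x) delta *: a r.2.

Let q : R := (n.+1%:R * m.+1%:R)^-1.

Lemma q_gt0 : 0 < q.
Proof. by rewrite invr_gt0 mulr_gt0 ?ltr0n. Qed.

Lemma q_card : q * #|{: 'I_n.+1 * 'I_m.+1}|%:R = 1.
Proof.
by rewrite card_prod !card_ord natrM mulVf // mulf_neq0 // pnatr_eq0.
Qed.

(** Unbiasedness of the sampled gradient: in the sum over pairs each [grad (fi i) x] occurs [m.+1]
    times and each barrier term [n.+1] times. *)
Lemma sample_grad_mean delta x :
  q *: \sum_r sample_grad delta x r = penalized_grad delta x.
Proof.
rewrite /penalized_grad grad_f /sample_grad big_split /=.
rewrite -(pair_bigA _ (fun i j => grad (fi i) x)) /=.
rewrite -(pair_bigA _ (fun i j => dbarrier (g j x) delta *: a j)) /=.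
under eq_bigr do rewrite sumr_const card_ord.
rewrite sumrMnl sumr_const card_ord scalerDr.
set u := \sum_i _; set v := \sum_j _.
rewrite -(scaler_nat m.+1 u) -(scaler_nat n.+1 v) !scalerA /q.
congr (_ *: _ + _ *: _); first by rewrite invfM mulfVK ?pnatr_eq0.
by rewrite mulrC invfM mulVKf ?pnatr_eq0.
Qed.

(** Compare with the value at [xs]: [sandwiched_lip] controls the difference, and [dbarrier_bound]
    bounds the value at [xs] uniformly in [delta] and [r]. *)
Lemma sample_grad_growth xs : exists2 C, 0 <= C &
  forall delta x r, delta_oo <= delta ->
  dot (sample_grad delta x r) (sample_grad delta x r)
    <= C * (1 + dot (x - xs) (x - xs)).
Proof.
pose K := L / 2 + barrier_smoothness.
have K0 : 0 < K.
  have : 0 <= barrier_smoothness.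
    by rewrite divr_ge0 ?(ltW delta_oo_gt0) // sumr_ge0 // => j _; exact: dot_ge0.
  by have := mu_gt0; have := mu_le; rewrite /K; lra.
pose s (j : 'I_m.+1) := (2 + `|g j xs| / delta_oo) ^+ 2 * dot (a j) (a j).
have s0 j : 0 <= s j by rewrite mulr_ge0 ?sqr_ge0 ?dot_ge0.
pose M := 2 * \sum_i dot (grad (fi i) xs) (grad (fi i) xs) + 2 * \sum_j s j.
have M0 : 0 <= M.
  by rewrite addr_ge0 // mulr_ge0 // sumr_ge0 // => i _; exact: dot_ge0.
have K20 : 0 <= 2 * (2 * K) ^+ 2 by rewrite mulr_ge0 ?sqr_ge0.
exists (2 * (2 * K) ^+ 2 + 2 * M) => [|delta x r dd]; first lra.
have h := sandwichedD _ _ _ _ _ _ _ _ (sandwiched_fi r.1) (sandwiched_barrier _ r.2 dd).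
rewrite addr0 in h.
have lip := sandwiched_lip _ _ _ xs x K0 h.
have Gs : dot (sample_grad delta xs r) (sample_grad delta xs r) <= M.
  apply: le_trans (dotD_le _ _) _; apply: lerD; apply: ler_wpM2l => //.
    rewrite (bigD1 r.1) //= lerDl; apply: sumr_ge0 => i _; exact: dot_ge0.
  apply: (@le_trans _ _ (s r.2)); last first.
    by rewrite (bigD1 r.2) //= lerDl; apply: sumr_ge0.
  rewrite dotZl dotZr mulrA -expr2; apply: ler_wpM2r; first exact: dot_ge0.
  rewrite -[leLHS]real_normK ?num_real // ler_sqr ?nnegrE //.
    exact: dbarrier_bound.
  by rewrite addr_ge0 // divr_ge0 // ltW.
have := dotD_le (sample_grad delta x r - sample_grad delta xs r) (sample_grad delta xs r).
rewrite subrK => /le_trans; apply.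
have V0 := dot_ge0 (x - xs).
have MV : 0 <= M * dot (x - xs) (x - xs) by exact: mulr_ge0.
move: lip; rewrite -/(sample_grad delta x r) -/(sample_grad delta xs r) => lip.
lra.
Qed.

(** Subtracting the vanishing gradient at [delta_oo] cancels the [f] part; [dbarrier_lip_delta]
    bounds what remains. *)
Lemma penalized_grad_bias xs : penalized_grad delta_oo xs = 0 -> exists2 C, 0 <= C &
  forall delta v, delta_oo <= delta ->
  `|dot (penalized_grad delta xs) v| <= C * (delta - delta_oo) * (1 + dot v v).
Proof.
move=> G0.
pose c (j : 'I_m.+1) := delta_oo^-1 + `|g j xs| / delta_oo ^+ 2.
have c0 j : 0 <= c j.
  by rewrite addr_ge0 ?divr_ge0 ?exprn_ge0 ?invr_ge0 ?(ltW delta_oo_gt0).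
exists (\sum_j c j * (dot (a j) (a j) + 1)) => [|delta v dd].
  by apply: sumr_ge0 => j _; rewrite mulr_ge0 // addr_ge0 // dot_ge0.
rewrite -[penalized_grad _ _]subr0 -G0 /penalized_grad opprD addrACA subrr add0r.
rewrite -scalerBr -sumrB dotZl dot_suml normrM.
apply: (@le_trans _ _ `|\sum_j dot (dbarrier (g j xs) delta *: a j
    - dbarrier (g j xs) delta_oo *: a j) v|).
  rewrite ler_piMl // ger0_norm ?invr_ge0 // invf_le1 ?ltr0n //.
  by rewrite ler1n.
apply: (le_trans (ler_norm_sum _ _ _)); rewrite -mulrA mulr_suml.
apply: ler_sum => j _; rewrite -scalerBl dotZl normrM.
have h1 := dbarrier_lip_delta (g j xs) _ _ delta_oo_gt0 dd.
have h2 := dot_young (a j) v _ ltr01.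
have v0 := dot_ge0 v; have a0 := dot_ge0 (a j).
rewrite (_ : _ * _ * _ = (delta - delta_oo) * c j *
  ((dot (a j) (a j) + 1) * (1 + dot v v))); last by ring.
apply: ler_pM => //; apply: (le_trans h2); rewrite divr1 mul1r.
have : 0 <= dot (a j) (a j) * dot v v by exact: mulr_ge0.
lra.
Qed.

(** Expand the square and average over the draws. Strong monotonicity and the bias at [xs] handle
    the first-order term, the growth bound the second-order one. *)
Lemma drift xs : penalized_grad delta_oo xs = 0 -> exists2 C, 0 <= C &
  forall (V : E -> R) (delta gamma beta : R) x,
  V = (fun y => dot (y - xs) (y - xs)) ->
  beta = C * (gamma * (delta - delta_oo)) + C * gamma ^+ 2 ->
  delta_oo <= delta -> 0 <= gamma ->
  q * \sum_r V (x - gamma *: sample_grad delta x r)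
    <= (1 + beta - 2 * mu * gamma) * V x + beta.
Proof.
move=> G0.
have [C1 C10 h1] := sample_grad_growth xs.
have [C2 C20 h2] := penalized_grad_bias xs G0.
(* [C1] comes from the [gamma ^+ 2] term and [2 * C2] from twice the bias; [p1] and [p2] below pay
   for using their sum in both places. *)
exists (C1 + 2 * C2) => [|V delta gamma beta x VD betaD dd gamma0].
  by lra.
have [w wE] : {w | w = x - xs} by exists (x - xs).
have VE r : V (x - gamma *: sample_grad delta x r) = dot w w
    - 2 * gamma * dot (sample_grad delta x r) w
    + gamma ^+ 2 * dot (sample_grad delta x r) (sample_grad delta x r).
  rewrite VD addrAC -wE; have [u <-] : {u | u = sample_grad delta x r} by eexists.
  by rewrite !dotE (dotC w u); ring.
have V0 : 0 <= dot w w := dot_ge0 w.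
apply: (@le_trans _ _ (q * \sum_r (dot w w
    - 2 * gamma * dot (sample_grad delta x r) w + gamma ^+ 2 * (C1 * (1 + dot w w))))).
  apply: ler_wpM2l; first exact: (ltW q_gt0).
  apply: ler_sum => r _; rewrite VE lerD2l; apply: ler_wpM2l; first exact: sqr_ge0.
  by rewrite wE; exact: h1.
rewrite !big_split /= sumrN -mulr_sumr !sumr_const -dot_suml.
rewrite -(mulr_natl (dot w w)) -(mulr_natl (gamma ^+ 2 * _)).
set S := \sum_r _; set N := #|_|%:R.
have qN : q * N = 1 := q_card.
have -> : q * (N * dot w w - 2 * gamma * dot S w + N * (gamma ^+ 2 * (C1 * (1 + dot w w))))
  = (q * N) * (dot w w + gamma ^+ 2 * (C1 * (1 + dot w w)))
    - 2 * gamma * dot (q *: S) w by rewrite dotZl; ring.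
rewrite qN mul1r sample_grad_mean.
have /= mono := sandwiched_monotone _ _ _ _ x xs (sandwiched_penalized _ dd).
rewrite -wE dotDl dotNl in mono.
have /ler_normlP[bias _] := h2 delta w dd.
have e0 : 0 <= gamma * (delta - delta_oo) by rewrite mulr_ge0 // subr_ge0.
have key : gamma * (mu * dot w w - C2 * (delta - delta_oo) * (1 + dot w w))
   <= gamma * dot (penalized_grad delta x) w.
  by apply: ler_wpM2l => //; lra.
have p1 : 0 <= C1 * (gamma * (delta - delta_oo)) * (1 + dot w w).
  by rewrite !mulr_ge0 //; lra.
have p2 : 0 <= C2 * gamma ^+ 2 * (1 + dot w w).
  by rewrite !mulr_ge0 ?sqr_ge0 //; lra.
by rewrite VD -wE betaD; lra.
Qed.

End Drift.

(** * Almost sure convergence of the iterates *)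

Theorem theorem1 (R : realType) (disp : measure_display)
    (T : measurableType disp) (P : probability T R)
    (d n m : nat)
    (fi : 'I_n.+1 -> 'rV[R]_d.+1 -> R)
    (a : 'I_m.+1 -> 'rV[R]_d.+1) (b : 'I_m.+1 -> R)
    (f : 'rV[R]_d.+1 -> R) (g : 'I_m.+1 -> 'rV[R]_d.+1 -> R)
    (mu L : R)
    (i_ : nat -> {RV P >-> 'I_n.+1}) (j_ : nat -> {RV P >-> 'I_m.+1})
    (delta_oo : R) (gamma epsilon delta : nat -> R)
    (x0 : 'rV[R]_d.+1) (X : nat -> T -> 'rV[R]_d.+1) :
  (forall i, C1 (fi i)) ->
  (forall x, f x = n.+1%:R^-1 * \sum_(i < n.+1) fi i x) ->
  (forall j x, g j x = dot (a j) x + b j) ->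
  0 < mu -> mu <= L ->
  (forall i (x y : 'rV[R]_d.+1),
     fi i y - fi i x <=
       dot (grad (fi i) x) (y - x) + L / 2 * norm2 (y - x) ^+ 2) ->
  (forall i (x y : 'rV[R]_d.+1), fi i y - fi i x >= dot (grad (fi i) x) (y - x)) ->
  (forall (x y : 'rV[R]_d.+1),
     f y - f x >= dot (grad f x) (y - x) + mu / 2 * norm2 (y - x) ^+ 2) ->
  [set x | forall j, g j x <= 0]° !=set0 ->
  independent_sigma_algebras P
    (fun s : nat + nat => match s with
                          | inl k => sigma_of (i_ k)
                          | inr k => sigma_of (j_ k)
                          end) ->
  (forall k, uniform_on_ord P (i_ k)) ->
  (forall k, uniform_on_ord P (j_ k)) ->
  0 < delta_oo ->
  (forall k, 0 < gamma k) ->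
  (forall k, 0 < epsilon k) ->
  (forall k, 0 < delta k) ->
  (forall k, delta k = delta_oo + epsilon k) ->
  (\sum_(0 <= k <oo) (gamma k)%:E = +oo)%E ->
  (\sum_(0 <= k <oo) (gamma k ^+ 2)%:E < +oo)%E ->
  (\sum_(0 <= k <oo) (gamma k * epsilon k)%:E < +oo)%E ->
  (forall w, X 0%N w = x0) ->
  (forall k w, X k.+1 w = X k w - gamma k *:
     (grad (fi (i_ k w)) (X k w)
      + grad (fun x => relaxed_barrier (g (j_ k w) x) (delta k)) (X k w))) ->
  exists xstar : 'rV[R]_d.+1,
    argmin (fun x => f x + m.+1%:R^-1 *
              \sum_(j < m.+1) relaxed_barrier (g j x) delta_oo) = [set xstar] /\
    {ae P, forall w, X ^~ w @ \oo --> xstar}.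
Proof.
move=> _ fE gE mu0 muL fi_up fi_lo f_lo _ indep i_unif j_unif doo0 gamma0 eps0 d0
  deltaE gamma_sum gamma2_sum gamma_eps_sum X0 XS.
have dd k : delta_oo <= delta k by rewrite deltaE lerDl ltW.
have {gE} gE : g = fun j x => dot (a j) x + b j.
  by apply/funext => j; apply/funext => x.
subst g.
have mu20 : 0 < mu / 2 by rewrite divr_gt0.
have [xs [xs_argmin xs_crit]] := sandwiched_argmin _ _ _ _ mu20
  (sandwiched_penalized fi a b f mu L delta_oo fE fi_up fi_lo f_lo doo0
    _ (lexx delta_oo)).
exists xs; split=> //.
have [C C0 hC] := drift _ _ _ _ _ _ _ fE mu0 muL fi_up fi_lo f_lo doo0 xs xs_crit.
(* Summable because [delta k - delta_oo] is [epsilon k]: the two terms are controlled by the series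
   of [gamma k * epsilon k] and of [gamma k ^+ 2]. *)
pose beta k := C * (gamma k * (delta k - delta_oo)) + C * gamma k ^+ 2.
have beta0 k : 0 <= beta k.
  by rewrite addr_ge0 // mulr_ge0 ?sqr_ge0 // mulr_ge0 ?subr_ge0 // ltW.
have [B hB] : exists B, forall k, \sum_(l < k) beta l <= B.
  have [B1 hB1] := nneseries_bounded _ (fun k => sqr_ge0 (gamma k)) gamma2_sum.
  have [B2 hB2] := nneseries_bounded _
    (fun k => mulr_ge0 (ltW (gamma0 k)) (ltW (eps0 k))) gamma_eps_sum.
  exists (C * B2 + C * B1) => k; rewrite big_split /= -!mulr_sumr.
  apply: lerD; apply: ler_wpM2l => //.
  by under eq_bigr do rewrite deltaE addrC addKr; exact: hB2.
  exact: hB1.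
have gammaS := nneseries_unbounded _ (fun k => ltW (gamma0 k)) gamma_sum.
pose Phi k x r := x - gamma k *: sample_grad fi a b (delta k) x r.
have XS' k w : X k.+1 w = Phi k (X k w) (pairs P n m i_ j_ k w).
  rewrite XS /Phi /sample_grad /=.
  (* The barrier gradient in the recursion is replaced by its closed form in [dbarrier]. *)
  by rewrite (sandwiched_grad _ _ _ _ _ (barrier_sandwiched (a (j_ k w)) (b (j_ k w)) _ (d0 k))).
have q0 := ltW (@q_gt0 R n m).
have c0 : 0 < 2 * mu by rewrite mulr_gt0.
pose V x := dot (x - xs) (x - xs).
have := robbins_siegmund P _ (pairs P n m i_ j_) Phi x0 X
  (@q_card R n m) q0 (measurable_pairs P n m i_ j_)
  (P_cyl_pairs P n m i_ j_ indep i_unif j_unif) X0 XS' V beta gamma (2 * mu) B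
  (fun x => dot_ge0 _) beta0 hB (fun k => ltW (gamma0 k)) gammaS c0
  (fun k x => hC V (delta k) (gamma k) (beta k) x erefl erefl (dd k) (ltW (gamma0 k))).
by apply: filterS => w hw; apply: cvg_of_dot.
Qed.
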